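(* Consider the $\text{R-FS}_{\varepsilon,\delta}$ algorithm with learning rate $\varepsilon>0$ and regularization parameter $\delta\in(0,\infty)$, where $\varepsilon\le\delta$. Then the regression coefficient vector $\hat\beta^k$ is feasible for the Lasso problem with parameter $\delta$ (i.e. $\|\hat\beta^k\|_1\le\delta$) for all $k\ge0$. Let $k\ge0$ denote a specific iteration counter. Then there exists an index $i\in\{0,\ldots,k\}$ for which the following bounds all hold: (i) (training error) $L_n(\hat\beta^i)-L^*_{n,\delta}\le\frac{\delta}{n}\left[\frac{\|\mathbf{X}\hat\beta_{LS}\|_2^2}{2\varepsilon(k+1)}+2\varepsilon\right]$; (ii) (predictions) for every Lasso solution $\hat\beta^*_\delta$, $$\|\mathbf{X}\hat\beta^i-\mathbf{X}\hat\beta^*_\delta\|_2\le\sqrt{\frac{\delta\|\mathbf{X}\hat\beta_{LS}\|_2^2}{\varepsilon(k+1)}+4\delta\varepsilon};$$ (iii) ($\ell_1$-shrinkage of coefficients) $\|\hat\beta^i\|_1\le\delta\left[1-\left(1-\tfrac{\varepsilon}{\delta}\right)^k\right]\le\delta$; (iv) (sparsity of coefficients) $\|\hat\beta^i\|_0\le k$.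
   Context: Standing data: $\mathbf{X}=[\mathbf{X}_1,\ldots,\mathbf{X}_p]\in\mathbb{R}^{n\times p}$ has columns with zero mean and unit $\ell_2$ norm, and $\mathbf{y}\in\mathbb{R}^n$ has zero mean. $L_n(\beta):=\frac{1}{2n}\|\mathbf{y}-\mathbf{X}\beta\|_2^2$. A least squares solution $\hat\beta_{LS}$ is any minimizer of $L_n$ over $\mathbb{R}^p$; $\mathbf{X}\hat\beta_{LS}$ does not depend on which minimizer is chosen. The Lasso problem with parameter $\delta$ is $L^*_{n,\delta}:=\min\{L_n(\beta):\beta\in\mathbb{R}^p,\ \|\beta\|_1\le\delta\}$; a Lasso solution $\hat\beta^*_\delta$ is any minimizer of it. $\|v\|_0$ is the number of nonzero entries of $v$. $\mathrm{sgn}(a)\in\{-1,0,1\}$ is the sign of $a$, with $\mathrm{sgn}(0)=0$. $e_j$ is the $j$-th unit vector. Algorithm $\text{R-FS}_{\varepsilon,\delta}$: initialize $\hat r^0=\mathbf{y}$, $\hat\beta^0=0$. For $k=0,1,\ldots$: choose any $j_k\in\arg\max_{j\in\{1,\ldots,p\}}|(\hat r^k)^T\mathbf{X}_j|$, set $\hat r^{k+1}=\hat r^k-\varepsilon\left[\mathrm{sgn}((\hat r^k)^T\mathbf{X}_{j_k})\mathbf{X}_{j_k}+\tfrac1\delta(\hat r^k-\mathbf{y})\right]$ and $\hat\beta^{k+1}=(1-\tfrac{\varepsilon}{\delta})\hat\beta^k+\varepsilon\,\mathrm{sgn}((\hat r^k)^T\mathbf{X}_{j_k})e_{j_k}$.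 *)

(* Defs.v *)
From mathcomp Require Import all_boot all_order all_algebra.
From mathcomp Require Import all_classical all_reals all_analysis.

Set Implicit Arguments.
Unset Strict Implicit.
Unset Printing Implicit Defensive.

Import Order.TTheory GRing.Theory Num.Theory.
Import numFieldNormedType.Exports.

Local Open Scope classical_set_scope.
Local Open Scope ring_scope.

(* The norm that the library puts on matrices is the sup norm. *)
Definition norm1 (R : realType) (m : nat) (v : 'cV[R]_m) : R :=
  \sum_i `|v i 0|.

Definition norm2 (R : realType) (m : nat) (v : 'cV[R]_m) : R :=
  Num.sqrt (\sum_i v i 0 ^+ 2).

Definition norm0 (R : realType) (m : nat) (v : 'cV[R]_m) : nat :=
  #|[set i | v i 0 != 0]%SET|.

Definition dotp (R : realType) (m : nat) (u v : 'cV[R]_m) : R :=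
  (u^T *m v) 0 0.

Definition mean (R : realType) (m : nat) (v : 'cV[R]_m) : R :=
  (\sum_i v i 0) / m%:R.

Definition ls_loss (R : realType) (n p : nat) (X : 'M[R]_(n, p))
    (y : 'cV[R]_n) (b : 'cV[R]_p) : R :=
  1 / (2 * n%:R) * norm2 (y - X *m b) ^+ 2.

Definition ls_solution (R : realType) (n p : nat) (X : 'M[R]_(n, p))
    (y : 'cV[R]_n) (b : 'cV[R]_p) : Prop :=
  forall c, ls_loss X y b <= ls_loss X y c.

Definition lasso_feasible (R : realType) (p : nat) (delta : R)
    (b : 'cV[R]_p) : Prop :=
  norm1 b <= delta.

(* An infimum over a nonempty compact set when 0 <= delta: it is attained,
   see lasso_solution_exists and lasso_value_min below. *)
Definition lasso_value (R : realType) (n p : nat) (X : 'M[R]_(n, p))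
    (y : 'cV[R]_n) (delta : R) : R :=
  inf [set ls_loss X y b | b in [set b | lasso_feasible delta b]].

Definition lasso_solution (R : realType) (n p : nat) (X : 'M[R]_(n, p))
    (y : 'cV[R]_n) (delta : R) (b : 'cV[R]_p) : Prop :=
  lasso_feasible delta b /\
  forall c, lasso_feasible delta c -> ls_loss X y b <= ls_loss X y c.

Definition max_corr (R : realType) (n p : nat) (X : 'M[R]_(n, p))
    (r : 'cV[R]_n) (j : 'I_p) : Prop :=
  forall l, `|dotp r (col l X)| <= `|dotp r (col j X)|.

(* [j k], [r k] and [beta k] are the index chosen at iteration k, the residual
   and the coefficients; ties in the argmax are broken arbitrarily. *)
Definition rfs_run (R : realType) (n p : nat) (X : 'M[R]_(n, p))
    (y : 'cV[R]_n) (eps delta : R)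
    (j : nat -> 'I_p) (r : nat -> 'cV[R]_n) (beta : nat -> 'cV[R]_p) : Prop :=
  [/\ r 0%N = y,
      beta 0%N = 0
    & forall k : nat,
      let s := Num.sg (dotp (r k) (col (j k) X)) in
      [/\ max_corr X (r k) (j k),
          r k.+1 = r k - eps *: (s *: col (j k) X + delta^-1 *: (r k - y))
        & beta k.+1 = (1 - eps / delta) *: beta k
                      + (eps * s) *: delta_mx (j k) 0]].

Lemma ls_loss_ge0 (R : realType) (n p : nat) (X : 'M[R]_(n, p))
    (y : 'cV[R]_n) (b : 'cV[R]_p) : 0 <= ls_loss X y b.
Proof. by rewrite /ls_loss mul1r mulr_ge0 ?sqr_ge0 // invr_ge0 mulr_ge0. Qed.

Lemma lasso_value_min (R : realType) (n p : nat) (X : 'M[R]_(n, p))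
    (y : 'cV[R]_n) (delta : R) (b : 'cV[R]_p) :
  lasso_solution X y delta b -> lasso_value X y delta = ls_loss X y b.
Proof.
move=> [fb minb]; apply/eqP; rewrite eq_le; apply/andP; split.
  apply: ge_inf; last by exists b.
  by exists 0 => _ [c _ <-]; exact: ls_loss_ge0.
apply: lb_le_inf; first by exists (ls_loss X y b); exists b.
by move=> _ [c fc <-]; exact: minb.
Qed.

Lemma norm2_sqr (R : realType) (m : nat) (v : 'cV[R]_m) :
  norm2 v ^+ 2 = \sum_i v i 0 ^+ 2.
Proof. by rewrite sqr_sqrtr // sumr_ge0 // => i _; rewrite sqr_ge0. Qed.

Lemma lasso_solution_exists (R : realType) (n p : nat) (X : 'M[R]_(n, p))
    (y : 'cV[R]_n) (delta : R) :
  0 <= delta -> exists b, lasso_solution X y delta b.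
Proof.
move=> d0.
have csum (I : finType) (f : I -> 'rV[R]_p -> R) :
    (forall i, continuous (f i)) -> continuous (fun v => \sum_i f i v).
  move=> cf.
  apply: (@continuous_big R I +%R 0 xpredT (@add_continuous R)) => i _.
  exact: cf.
pose A : set 'rV[R]_p := [set v | norm1 v^T <= delta].
have norm1E v : norm1 v^T = \sum_k `|v 0 k : R|.
  by apply: eq_bigr => k _; rewrite mxE.
have A0 : A !=set0.
  by exists 0; rewrite /A /= norm1E big1 // => k _; rewrite mxE normr0.
have cA : compact A.
  apply: (@subclosed_compact _ A
      [set v : 'rV[R]_p | forall k, `[- delta, delta]%classic (v ord0 k)]).
  - apply: (@preimage_closed _ _ (fun v : 'rV[R]_p => norm1 v^T)
        [set x | x <= delta]); last exact: closed_le.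
    move=> v _; under eq_fun do rewrite norm1E.
    apply: (csum) => k w; apply: continuous_comp; first exact: coord_continuous.
    exact: norm_continuous.
  - by apply: (@rV_compact _ _ (fun=> `[- delta, delta]%classic)) => _;
      exact: segment_compact.
  - move=> v; rewrite /A /= norm1E => vd k; rewrite /= in_itv /= -ler_norml.
    apply: le_trans vd; rewrite (bigD1 k) //= lerDl.
    by rewrite sumr_ge0.
have ccst (a : R) : continuous (fun _ : 'rV[R]_p => a).
  exact: cst_continuous.
have cM (f g : 'rV[R]_p -> R) :
    continuous f -> continuous g -> continuous (fun v => f v * g v).
  by move=> cf cg v; exact: (cvgM (cf v) (cg v)).
have cD (f g : 'rV[R]_p -> R) :
    continuous f -> continuous g -> continuous (fun v => f v + g v).
  by move=> cf cg v; exact: (cvgD (cf v) (cg v)).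
have cmx i : continuous (fun v : 'rV[R]_p => (y - X *m v^T) i 0).
  have -> : (fun v : 'rV[R]_p => (y - X *m v^T) i 0) =
            (fun v => y i 0 + -1 * \sum_k X i k * v 0 k).
    apply/funext => v; rewrite !mxE mulN1r; congr (_ - _).
    by apply: eq_bigr => k _; rewrite mxE.
  apply: (cD); first exact: ccst.
  apply: (cM); first exact: ccst.
  apply: (csum) => k; apply: (cM); first exact: ccst.
  by move=> w; exact: coord_continuous.
have cf : continuous (fun v : 'rV[R]_p => ls_loss X y v^T).
  apply: (cM); first exact: ccst.
  under eq_fun do rewrite norm2_sqr.
  by apply: (csum) => i; apply: (cM).
have [c cA' minc] := EVT_min_rV A0 cA (continuous_subspaceT cf).
exists c^T; split; first by move: cA'; rewrite inE.
by move=> b fb; rewrite -[b]trmxK; apply: minc; rewrite inE /A /= trmxK.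
Qed.

Lemma ls_solution_exists (R : realType) (n p : nat) (X : 'M[R]_(n, p))
    (y : 'cV[R]_n) : exists b, ls_solution X y b.
Proof.
have nsq (v : 'cV[R]_n) : norm2 v ^+ 2 = dotp v v.
  by rewrite norm2_sqr /dotp mxE; apply: eq_bigr => i _; rewrite mxE expr2.
have dotp_eq0 m (M : 'M[R]_(n, m)) : M^T *m M = 0 -> M = 0.
  move=> /matrixP M0; apply/matrixP => i k; rewrite mxE.
  have /eqP := M0 k k; rewrite !mxE.
  under eq_bigr do rewrite mxE -expr2.
  rewrite psumr_eq0 => [|l _]; last exact: sqr_ge0.
  by move=> /allP /(_ i (mem_index_enum _)) /=; rewrite sqrf_eq0 => /eqP.
have /submxP[u Hu] : (y^T *m X <= X^T *m X)%MS.
  rewrite submxE; set C := cokermx _.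
  have : X *m C = 0.
    apply: dotp_eq0; rewrite trmx_mul -mulmxA [X^T *m _]mulmxA.
    by rewrite mulmx_coker mulmx0.
  by move=> XC; rewrite -mulmxA XC mulmx0.
exists u^T => c; rewrite /ls_loss ler_wpM2l //.
pose e := y - X *m u^T; pose d := X *m (u^T - c).
have -> : y - X *m c = e + d by rewrite /e /d mulmxBr addrA subrK.
rewrite -/e.
have eX : e^T *m X = 0.
  rewrite /e [(_ - _)^T]linearB /= trmx_mul trmxK mulmxBl.
  by rewrite -mulmxA -Hu subrr.
have ed : e^T *m d = 0 by rewrite /d mulmxA eX mul0mx.
have de : d^T *m e = 0 by rewrite -[e]trmxK -trmx_mul ed trmx0.
clearbody e d; rewrite !nsq /dotp [(_ + _)^T]linearD /= mulmxDl !mulmxDr ed de.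
rewrite addr0 add0r [leRHS]mxE lerDl.
by rewrite -/(dotp d d) -nsq sqr_ge0.
Qed.

(* Main.v *)
Require Import Defs.
From mathcomp Require Import all_boot all_order all_algebra.
From mathcomp Require Import all_classical all_reals all_analysis.
From mathcomp Require Import ring lra.

Set Implicit Arguments.
Unset Strict Implicit.
Unset Printing Implicit Defensive.

Import Order.TTheory GRing.Theory Num.Theory.
Local Open Scope ring_scope.

(** R-FS is subgradient descent on the residual and, at the same time, a
    Frank-Wolfe method on the coefficients.  Write [w] for the direction
    [s e_j - beta / delta]: the two updates read [beta + eps w] and
    [r - eps X w], so [r = y - X beta] throughout ([rfs_residual]).  Everything
    is governed by the gap [G = <r, X w>].

    On one hand, the index [j] maximizes the correlation with [r], so the
    vertex [delta s e_j] maximizes [<r, X b>] over the l1 ball of radius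
    [delta].  Expanding the square of the residual of any feasible [b] around
    [r] then shows that [2 delta G] dominates the excess of the squared residual
    of [beta] over that of [b], plus the squared distance of the predictions
    ([gap_bound]).  A bound on [G] thus gives the training error and the
    prediction bounds together.

    On the other hand, the squared residual telescopes: each step lowers it by
    [2 eps G - eps^2 |X w|^2].  Here [|X w| <= 2], because [X] has unit columns
    and [w] has l1 norm at most 2.  The total decrease is at most
    [|X beta_LS|^2], since no residual is shorter than the least squares
    residual, which is orthogonal to [X beta_LS] ([ls_decrease]).  So the average
    of [G] over the iterations [0, ..., k] is at most
    [|X beta_LS|^2 / (2 eps (k + 1)) + 2 eps], and some iteration [i] does as
    well as this average ([small_gap]).

    The l1 norm and the number of nonzero coefficients are controlled at every
    iteration, by induction on the update of [beta]. *)

(** * Inner products and norms *)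

Lemma dotpDr (R : realType) m (u v w : 'cV[R]_m) :
  dotp u (v + w) = dotp u v + dotp u w.
Proof. by rewrite /dotp mulmxDr mxE. Qed.

Lemma dotpZr (R : realType) m (a : R) (u v : 'cV[R]_m) :
  dotp u (a *: v) = a * dotp u v.
Proof. by rewrite /dotp -scalemxAr mxE. Qed.

Lemma dotpC (R : realType) m (u v : 'cV[R]_m) : dotp u v = dotp v u.
Proof.
by rewrite /dotp !mxE; apply: eq_bigr => i _; rewrite !mxE mulrC.
Qed.

Lemma norm2_sqr_dotp (R : realType) m (v : 'cV[R]_m) :
  norm2 v ^+ 2 = dotp v v.
Proof.
by rewrite norm2_sqr /dotp mxE; apply: eq_bigr => i _; rewrite mxE expr2.
Qed.

Lemma norm2_ge0 (R : realType) m (v : 'cV[R]_m) : 0 <= norm2 v.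
Proof. exact: sqrtr_ge0. Qed.

Lemma dim_gt0_unit (R : realType) n (v : 'cV[R]_n) : norm2 v = 1 -> (0 < n)%N.
Proof.
case: n v => // v; rewrite /norm2 big_ord0 sqrtr0 => /eqP.
by rewrite eq_sym oner_eq0.
Qed.

Lemma norm2_sqrD (R : realType) m (a : R) (u v : 'cV[R]_m) :
  norm2 (u + a *: v) ^+ 2
  = norm2 u ^+ 2 + 2 * a * dotp u v + a ^+ 2 * norm2 v ^+ 2.
Proof.
rewrite !norm2_sqr_dotp dotpDr dotpZr (dotpC (u + _) u) (dotpC (u + _) v).
by rewrite !dotpDr !dotpZr (dotpC v u); ring.
Qed.

Lemma norm1_ge0 (R : realType) m (v : 'cV[R]_m) : 0 <= norm1 v.
Proof. exact: sumr_ge0. Qed.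

Lemma norm1D (R : realType) m (u v : 'cV[R]_m) :
  norm1 (u + v) <= norm1 u + norm1 v.
Proof.
by rewrite /norm1 -big_split; apply: ler_sum => i _; rewrite mxE ler_normD.
Qed.

Lemma norm1Z (R : realType) m (a : R) (v : 'cV[R]_m) :
  norm1 (a *: v) = `|a| * norm1 v.
Proof. by rewrite /norm1 mulr_sumr; apply: eq_bigr => i _; rewrite mxE normrM. Qed.

Lemma norm1_delta (R : realType) m (j : 'I_m) :
  norm1 (delta_mx j 0 : 'cV[R]_m) = 1.
Proof.
rewrite /norm1 (bigD1 j) //= mxE !eqxx normr1 big1 ?addr0 // => i ij.
by rewrite mxE (negPf ij) normr0.
Qed.

Lemma norm0D_delta (R : realType) m (a c : R) (v : 'cV[R]_m) (j : 'I_m) :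
  (norm0 (a *: v + c *: delta_mx j 0)%R <= (norm0 v).+1)%N.
Proof.
rewrite /norm0; set S := [set i : 'I_m | v i 0 != 0]%SET.
apply: (@leq_trans #|j |: S|); last by rewrite cardsU1 -add1n leq_add2r leq_b1.
apply/subset_leq_card/fintype.subsetP => i; rewrite !inE !mxE eqxx andbT.
have [//|_] := eqVneq i j; apply: contra => /eqP ->.
by rewrite !mulr0 addr0.
Qed.

(** * Linear models with unit columns *)

(** Hölder's inequality between the l1 norm of [v] and the largest correlation
    of [r] with a column. *)
Lemma dotp_mulmx_le (R : realType) n p (X : 'M[R]_(n, p)) (r : 'cV[R]_n)
    (v : 'cV[R]_p) (M : R) :
  (forall l, `|dotp r (col l X)| <= M) ->
  `|dotp r (X *m v)| <= M * norm1 v.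
Proof.
move=> rM; have -> : dotp r (X *m v) = \sum_l dotp r (col l X) * v l 0.
  rewrite /dotp mulmxA mxE; apply: eq_bigr => l _.
  by rewrite colE mulmxA -colE [in RHS]mxE.
apply: le_trans (ler_norm_sum _ _ _) _.
by rewrite /norm1 mulr_sumr; apply: ler_sum => l _; rewrite normrM ler_wpM2r.
Qed.

Lemma dotp_unit_le1 (R : realType) n (u v : 'cV[R]_n) :
  norm2 u = 1 -> norm2 v = 1 -> `|dotp u v| <= 1.
Proof.
move=> u1 v1; rewrite ler_norml.
have := sqr_ge0 (norm2 (u + 1 *: v)); have := sqr_ge0 (norm2 (u + -1 *: v)).
by rewrite !norm2_sqrD u1 v1 => *; apply/andP; split; lra.
Qed.

(** Hölder applies twice: to a column against [X v], and then, with the bound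
    so obtained on the correlations, to [X v] against itself. *)
Lemma norm2_mulmx_le (R : realType) n p (X : 'M[R]_(n, p)) (v : 'cV[R]_p) :
  (forall l, norm2 (col l X) = 1) ->
  norm2 (X *m v) ^+ 2 <= norm1 v ^+ 2.
Proof.
move=> X1; rewrite norm2_sqr_dotp expr2.
apply: le_trans (ler_norm _) _; apply: dotp_mulmx_le => l.
rewrite dotpC -[leRHS]mul1r; apply: dotp_mulmx_le => l'.
exact: dotp_unit_le1.
Qed.

Lemma ls_loss_le (R : realType) n p (X : 'M[R]_(n, p)) (y : 'cV[R]_n)
    (b c : 'cV[R]_p) : (0 < n)%N ->
  (ls_loss X y b <= ls_loss X y c)
  = (norm2 (y - X *m b) ^+ 2 <= norm2 (y - X *m c) ^+ 2).
Proof. by move=> n0; rewrite /ls_loss ler_pM2l // divr_gt0 // mulr_gt0 // ltr0n. Qed.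

(** Minimality along the ray through [b]. *)
Lemma ls_orthogonal (R : realType) n p (X : 'M[R]_(n, p)) (y : 'cV[R]_n)
    (b : 'cV[R]_p) : (0 < n)%N -> ls_solution X y b ->
  dotp (y - X *m b) (X *m b) = 0.
Proof.
move=> n0 minb; set e := y - _; set d := X *m b.
set a := dotp e d; set D := norm2 d ^+ 2.
have D1 : 0 < D + 1 by rewrite ltr_wpDl // sqr_ge0.
(* Without the 1, [t] would be the minimizer along the ray; adding it spares the
   case [d = 0], and the step still lowers the loss unless [a = 0]. *)
pose t := a / (D + 1).
have := minb ((1 + t) *: b); rewrite ls_loss_le // -/e.
have -> : y - X *m ((1 + t) *: b) = e + (- t) *: d.
  by rewrite -scalemxAr scalerDl scale1r opprD addrA scaleNr.
rewrite norm2_sqrD -/a -/D -addrA lerDl.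
have -> : 2 * - t * a + (- t) ^+ 2 * D = - (t ^+ 2 * (D + 2)).
  have -> : a = t * (D + 1) by rewrite /t divfK // gt_eqF.
  by ring.
rewrite oppr_ge0 pmulr_lle0; last by rewrite ltr_wpDl // sqr_ge0.
move=> t2; have /eqP : t ^+ 2 == 0 by rewrite eq_le t2 sqr_ge0.
move/eqP; rewrite sqrf_eq0 /t mulf_eq0 invr_eq0 (gt_eqF D1) orbF.
by move/eqP.
Qed.

Lemma ls_decrease (R : realType) n p (X : 'M[R]_(n, p)) (y : 'cV[R]_n)
    (b c : 'cV[R]_p) : (0 < n)%N -> ls_solution X y b ->
  norm2 y ^+ 2 - norm2 (y - X *m c) ^+ 2 <= norm2 (X *m b) ^+ 2.
Proof.
move=> n0 lsb; have := lsb c; rewrite ls_loss_le //.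
have := norm2_sqrD 1 (y - X *m b) (X *m b).
by rewrite ls_orthogonal // scale1r subrK; lra.
Qed.

(** * The R-FS direction and its gap *)

Definition rfs_dir (R : realType) n p (X : 'M[R]_(n, p)) (delta : R)
    (j : 'I_p) (r : 'cV[R]_n) (b : 'cV[R]_p) : 'cV[R]_p :=
  Num.sg (dotp r (col j X)) *: delta_mx j 0 - delta^-1 *: b.

Definition rfs_gap (R : realType) n p (X : 'M[R]_(n, p)) (delta : R)
    (j : 'I_p) (r : 'cV[R]_n) (b : 'cV[R]_p) : R :=
  dotp r (X *m rfs_dir X delta j r b).

Lemma mulmx_rfs_dir (R : realType) n p (X : 'M[R]_(n, p)) (delta : R)
    (j : 'I_p) (r : 'cV[R]_n) (b : 'cV[R]_p) :
  X *m rfs_dir X delta j r b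
  = Num.sg (dotp r (col j X)) *: col j X - delta^-1 *: (X *m b).
Proof. by rewrite /rfs_dir mulmxBr -!scalemxAr -colE. Qed.

Lemma norm1_sg_delta (R : realType) m (x : R) (j : 'I_m) :
  norm1 (Num.sg x *: delta_mx j 0 : 'cV[R]_m) <= 1.
Proof. by rewrite norm1Z norm1_delta mulr1 normr_sg lern1 leq_b1. Qed.

Lemma norm1_rfs_dir (R : realType) n p (X : 'M[R]_(n, p)) (delta : R)
    (j : 'I_p) (r : 'cV[R]_n) (b : 'cV[R]_p) :
  0 < delta -> lasso_feasible delta b -> norm1 (rfs_dir X delta j r b) <= 2.
Proof.
move=> d0 fb; rewrite /rfs_dir -scaleNr.
apply: le_trans (norm1D _ _) _; rewrite -[2]/(1 + 1) lerD ?norm1_sg_delta //.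
by rewrite norm1Z normrN gtr0_norm ?invr_gt0 // mulrC ler_pdivrMr // mul1r.
Qed.

(** The step towards the vertex [delta s e_j] is at least as well correlated
    with the residual [r] as the step towards [c]; expanding the square of
    [r + (X b - X c)], the residual of [c], shows that the latter correlation is
    half the left-hand side. *)
Lemma gap_bound (R : realType) n p (X : 'M[R]_(n, p)) (y : 'cV[R]_n)
    (delta : R) (j : 'I_p) (b c : 'cV[R]_p) (r := y - X *m b) :
  0 < delta -> max_corr X r j -> lasso_feasible delta c ->
  norm2 r ^+ 2 - norm2 (y - X *m c) ^+ 2 + norm2 (X *m b - X *m c) ^+ 2
  <= 2 * delta * rfs_gap X delta j r b.
Proof.
move=> d0 mj fc; set M := `|dotp r (col j X)|.
have -> : rfs_gap X delta j r b = M - delta^-1 * dotp r (X *m b).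
  by rewrite /rfs_gap mulmx_rfs_dir -scaleNr dotpDr !dotpZr -normrEsg mulNr.
have hc : dotp r (X *m c) <= M * delta.
  apply: le_trans (ler_norm _) _; apply: le_trans (dotp_mulmx_le _ mj) _.
  by rewrite ler_wpM2l.
have -> : y - X *m c = r + 1 *: (X *m b - X *m c).
  by rewrite scale1r /r addrA subrK.
rewrite norm2_sqrD -(scaleN1r (X *m c)) dotpDr dotpZr.
have -> : 2 * delta * (M - delta^-1 * dotp r (X *m b))
          = 2 * (M * delta - dotp r (X *m b)).
  by field; rewrite gt_eqF.
lra.
Qed.

(** * Runs of the algorithm *)

Lemma rfs_beta_step (R : realType) n p (X : 'M[R]_(n, p)) (y : 'cV[R]_n)
    (eps delta : R) j r beta k : rfs_run X y eps delta j r beta ->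
  beta k.+1 = beta k + eps *: rfs_dir X delta (j k) (r k) (beta k).
Proof.
move=> [_ _ /(_ k)[_ _ ->]]; rewrite /rfs_dir scalerBr !scalerA scalerBl scale1r.
by rewrite addrA addrAC.
Qed.

Lemma rfs_residual (R : realType) n p (X : 'M[R]_(n, p)) (y : 'cV[R]_n)
    (eps delta : R) j r beta k : rfs_run X y eps delta j r beta ->
  r k = y - X *m beta k.
Proof.
move=> run; elim: k => [|k IH].
  by case: run => -> -> _; rewrite mulmx0 subr0.
rewrite (rfs_beta_step _ run) mulmxDr opprD addrA -IH -scalemxAr mulmx_rfs_dir.
have rky : r k - y = - (X *m beta k) by rewrite IH addrAC subrr sub0r.
by case: run => _ _ /(_ k)[_ -> _]; rewrite rky scalerN.
Qed.

(** The new coefficients are a convex combination, of weights [1 - eps / delta]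
    and [eps / delta], of the old ones and of a point of l1 norm at most
    [delta]; the defect of the l1 norm to [delta] shrinks at worst
    geometrically. *)
Lemma rfs_norm1 (R : realType) n p (X : 'M[R]_(n, p)) (y : 'cV[R]_n)
    (eps delta : R) j r beta k :
  0 < eps -> 0 < delta -> eps <= delta -> rfs_run X y eps delta j r beta ->
  norm1 (beta k) <= delta * (1 - (1 - eps / delta) ^+ k).
Proof.
move=> e0 d0 ed [_ beta0 step]; elim: k => [|k IH].
  by rewrite beta0 subrr mulr0 /norm1 big1 // => i _; rewrite mxE normr0.
have q0 : 0 <= 1 - eps / delta by rewrite subr_ge0 ler_pdivrMr // mul1r.
case: (step k) => _ _ ->; apply: le_trans (norm1D _ _) _.
rewrite -scalerA (norm1Z (1 - _)) (norm1Z eps) (ger0_norm q0) (gtr0_norm e0).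
have -> : delta * (1 - (1 - eps / delta) ^+ k.+1)
          = (1 - eps / delta) * (delta * (1 - (1 - eps / delta) ^+ k)) + eps * 1.
  by rewrite exprS; field; rewrite gt_eqF.
by rewrite lerD // ?ler_wpM2l // ?norm1_sg_delta // ltW.
Qed.

Lemma rfs_feasible (R : realType) n p (X : 'M[R]_(n, p)) (y : 'cV[R]_n)
    (eps delta : R) j r beta k :
  0 < eps -> 0 < delta -> eps <= delta -> rfs_run X y eps delta j r beta ->
  lasso_feasible delta (beta k).
Proof.
move=> e0 d0 ed run; apply: le_trans (rfs_norm1 k e0 d0 ed run) _.
by rewrite ler_piMr ?(ltW d0) // gerBl exprn_ge0 // subr_ge0 ler_pdivrMr // mul1r.
Qed.

Lemma rfs_norm0 (R : realType) n p (X : 'M[R]_(n, p)) (y : 'cV[R]_n)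
    (eps delta : R) j r beta k : rfs_run X y eps delta j r beta ->
  (norm0 (beta k) <= k)%N.
Proof.
move=> [_ beta0 step]; elim: k => [|k IH].
  rewrite beta0 /norm0 (_ : [set _ | _]%SET = finset.set0) ?cards0 //.
  by apply/setP => i; rewrite !inE mxE eqxx.
by case: (step k) => _ _ ->; apply: leq_trans (norm0D_delta _ _ _ _) _.
Qed.

(** * The average gap *)

Lemma rfs_residual_descent (R : realType) n p (X : 'M[R]_(n, p))
    (y : 'cV[R]_n) (eps delta : R) j r beta k :
  (forall l, norm2 (col l X) = 1) ->
  0 < eps -> 0 < delta -> eps <= delta -> rfs_run X y eps delta j r beta ->
  2 * eps * rfs_gap X delta (j k) (r k) (beta k)
  <= norm2 (r k) ^+ 2 - norm2 (r k.+1) ^+ 2 + 4 * eps ^+ 2.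
Proof.
move=> X1 e0 d0 ed run; set w := rfs_dir X delta (j k) (r k) (beta k).
have -> : r k.+1 = r k + (- eps) *: (X *m w).
  rewrite !(rfs_residual _ run) (rfs_beta_step _ run) mulmxDr opprD addrA.
  by rewrite -scalemxAr scaleNr.
have w2 : norm2 (X *m w) ^+ 2 <= 4.
  apply: le_trans (norm2_mulmx_le _ X1) _.
  have -> : 4 = 2 ^+ 2 :> R by rewrite -natrX.
  rewrite ler_pXn2r ?nnegrE ?norm1_ge0 //.
  exact/norm1_rfs_dir/(rfs_feasible _ e0 d0 ed run).
have := ler_wpM2l (sqr_ge0 eps) w2.
rewrite norm2_sqrD sqrrN /rfs_gap -/w; lra.
Qed.

Lemma le_mean_exists (R : realType) (G : nat -> R) (B : R) k :
  \sum_(i < k.+1) G i <= k.+1%:R * B -> exists2 i, (i <= k)%N & G i <= B.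
Proof.
move=> GB; have [/existsP[i Gi]|/existsPn nG] :=
  boolP [exists i : 'I_k.+1, G i <= B].
  by exists i; rewrite // -ltnS.
move: GB; rewrite leNgt => /negP[]; rewrite mulr_natl.
rewrite -[in ltLHS](card_ord k.+1) -sumr_const.
apply: ltr_sum => [|i _]; first by apply/hasP; exists ord0; rewrite ?mem_index_enum.
by rewrite ltNge nG.
Qed.

Lemma small_gap (R : realType) n p (X : 'M[R]_(n, p)) (y : 'cV[R]_n)
    (eps delta : R) j r beta (b : 'cV[R]_p) k :
  (0 < n)%N -> (forall l, norm2 (col l X) = 1) ->
  0 < eps -> 0 < delta -> eps <= delta -> rfs_run X y eps delta j r beta ->
  ls_solution X y b ->
  exists2 i, (i <= k)%N & rfs_gap X delta (j i) (r i) (beta i)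
    <= norm2 (X *m b) ^+ 2 / (2 * eps * k.+1%:R) + 2 * eps.
Proof.
move=> n0 X1 e0 d0 ed run lsb; apply: le_mean_exists.
set S := \sum_(_ < _) _.
have telescope : 2 * eps * S
    <= norm2 (r 0%N) ^+ 2 - norm2 (r k.+1) ^+ 2 + k.+1%:R * (4 * eps ^+ 2).
  rewrite mulr_sumr.
  apply: (@le_trans _ _ (\sum_(i < k.+1)
      (norm2 (r i) ^+ 2 - norm2 (r i.+1) ^+ 2 + 4 * eps ^+ 2))).
    apply: ler_sum => i _; exact: (rfs_residual_descent i X1 e0 d0 ed run).
  rewrite big_split /= sumr_const card_ord (mulr_natl (4 * _)) lerD2r.
  suff -> : \sum_(i < k.+1) (norm2 (r i) ^+ 2 - norm2 (r i.+1) ^+ 2)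
            = norm2 (r 0%N) ^+ 2 - norm2 (r k.+1) ^+ 2 by [].
  elim: k.+1 => [|m IH]; first by rewrite big_ord0 subrr.
  by rewrite big_ord_recr IH /= addrA subrK.
have := ls_decrease (beta k.+1) n0 lsb.
have r0 : r 0%N = y by case: run.
rewrite -(rfs_residual _ run) -{1}r0 => decrease.
have e2 : 0 < 2 * eps by rewrite mulr_gt0.
rewrite -(ler_pM2l e2).
have -> : 2 * eps * (k.+1%:R * (norm2 (X *m b) ^+ 2 / (2 * eps * k.+1%:R)
             + 2 * eps)) = norm2 (X *m b) ^+ 2 + k.+1%:R * (4 * eps ^+ 2).
  have := pnatr_eq0 R k.+1; move: k.+1%:R => K /negbT K0.
  by field; rewrite K0 gt_eqF.
lra.
Qed.

Theorem theorem4p1 (R : realType) (n p : nat)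
    (X : 'M[R]_(n, p)) (y : 'cV[R]_n)
    (X_mean : forall l : 'I_p, mean (col l X) = 0)
    (X_norm : forall l : 'I_p, norm2 (col l X) = 1)
    (y_mean : mean y = 0)
    (eps delta : R) (eps_gt0 : 0 < eps) (delta_gt0 : 0 < delta)
    (eps_le_delta : eps <= delta)
    (j : nat -> 'I_p) (r : nat -> 'cV[R]_n) (beta : nat -> 'cV[R]_p)
    (run : rfs_run X y eps delta j r beta) :
  (forall k : nat, lasso_feasible delta (beta k)) /\
  (forall (k : nat) (beta_LS : 'cV[R]_p), ls_solution X y beta_LS ->
    exists i : nat, (i <= k)%N /\
      [/\ ls_loss X y (beta i) - lasso_value X y delta
            <= delta / n%:R *
               (norm2 (X *m beta_LS) ^+ 2 / (2 * eps * (k.+1)%:R) + 2 * eps),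
          forall beta_star : 'cV[R]_p, lasso_solution X y delta beta_star ->
            norm2 (X *m beta i - X *m beta_star)
              <= Num.sqrt (delta * norm2 (X *m beta_LS) ^+ 2
                             / (eps * (k.+1)%:R)
                           + 4 * delta * eps),
          norm1 (beta i) <= delta * (1 - (1 - eps / delta) ^+ k) <= delta
        & (norm0 (beta i) <= k)%N]).
Proof.
split=> [k|k beta_LS lsb]; first exact: (rfs_feasible _ _ _ _ run).
have n0 := dim_gt0_unit (X_norm (j 0%N)).
have [i ik gap_i] := small_gap k n0 X_norm eps_gt0 delta_gt0 eps_le_delta run lsb.
exists i; split=> //; set B := _ / _ + _ in gap_i *.
have excess c : lasso_feasible delta c ->
    norm2 (y - X *m beta i) ^+ 2 - norm2 (y - X *m c) ^+ 2
    + norm2 (X *m beta i - X *m c) ^+ 2 <= 2 * delta * B.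
  move=> fc; have mj : max_corr X (y - X *m beta i) (j i).
    by rewrite -(rfs_residual _ run); case: run => _ _ /(_ i)[].
  apply: le_trans (gap_bound delta_gt0 mj fc) _.
  by rewrite -(rfs_residual _ run) ler_pM2l // mulr_gt0.
have q0 : 0 <= 1 - eps / delta by rewrite subr_ge0 ler_pdivrMr // mul1r.
split.
- have [c solc] := lasso_solution_exists X y (ltW delta_gt0).
  rewrite (lasso_value_min solc) /ls_loss.
  have := excess c (proj1 solc).
  have := sqr_ge0 (norm2 (X *m beta i - X *m c)) => c0 excess_c.
  have nR : 0 < n%:R :> R by rewrite ltr0n.
  rewrite -mulrBr div1r mulrC ler_pdivrMr ?mulr_gt0 //.
  have -> : delta / n%:R * B * (2 * n%:R) = 2 * delta * B.
    by field; rewrite gt_eqF.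
  lra.
- move=> c [fc minc].
  have := minc (beta i) (rfs_feasible i eps_gt0 delta_gt0 eps_le_delta run).
  rewrite ls_loss_le // => loss_c; have excess_c := excess c fc.
  rewrite -[leLHS](ger0_norm (norm2_ge0 _)) -sqrtr_sqr ler_wsqrtr //.
  have -> : delta * norm2 (X *m beta_LS) ^+ 2 / (eps * k.+1%:R)
            + 4 * delta * eps = 2 * delta * B.
    rewrite /B; have := pnatr_eq0 R k.+1; move: k.+1%:R => K /negbT K0.
    by field; rewrite K0 gt_eqF.
  lra.
- apply/andP; split; last by rewrite ler_piMr ?(ltW delta_gt0) // gerBl exprn_ge0.
  apply: le_trans (rfs_norm1 i eps_gt0 delta_gt0 eps_le_delta run) _.
  rewrite ler_pM2l // lerD2l lerN2 ler_wiXn2l // gerBl divr_ge0 //; exact: ltW.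
- exact: leq_trans (rfs_norm0 i run) ik.
Qed.
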